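(* Let $k\ge 1$ be an integer. Given a pseudohalfplane arrangement $\mathcal H$, one can color the pseudohalfplanes of $\mathcal H$ with $k$ colors such that for every point $p$ of the plane, if the subset $\mathcal H_p\subset\mathcal H$ of pseudohalfplanes containing $p$ has at least $3k-2$ elements, then $\mathcal H_p$ contains a pseudohalfplane of every color.
   Context: A pseudoline arrangement is a finite collection of simple curves in the plane such that each curve cuts the plane into two components (both ends of each curve are at infinity), any two of the curves are either disjoint or intersect exactly once, and at the intersection point they cross; moreover the curves are in general position, i.e. no three of them have a common point. A pseudohalfplane arrangement is a pseudoline arrangement with a side of each pseudoline selected; the selected sides are the pseudohalfplanes. *)

(* Defs.v *)
From HB Require Import structures.
From mathcomp Require Import all_boot all_order all_algebra.
From mathcomp Require Import all_classical all_reals all_analysis.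

Set Implicit Arguments.
Unset Strict Implicit.
Unset Printing Implicit Defensive.

Import Order.TTheory GRing.Theory Num.Theory.
Import numFieldNormedType.Exports.

Local Open Scope classical_set_scope.
Local Open Scope ring_scope.

Notation plane R := (R * R)%type.

(* The norm on [plane R] is the maximum norm; the choice of the norm does not
   affect the meaning of "both ends at infinity". *)
Definition simple_curve_to_infinity (R : realType) (g : R -> plane R) : Prop :=
  [/\ continuous g,
      injective g,
      `|g t| @[t --> -oo] --> +oo &
      `|g t| @[t --> +oo] --> +oo].

(* The sides do not contain the points of [L] itself. *)
Definition sides (R : realType) (L : set (plane R)) : set (set (plane R)) :=
  connected_component (~` L) @` (~` L).

Definition pseudoline (R : realType) (L : set (plane R)) : Prop :=
  (exists2 g : R -> plane R, simple_curve_to_infinity g & range g = L) /\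
  (exists A B : set (plane R), A <> B /\ sides L = [set A; B]).

(* [M], traversed along some parametrization, changes sides of [L] at [p]. *)
Definition changes_side (R : realType) (M L : set (plane R)) (p : plane R) :
    Prop :=
  exists (g : R -> plane R) (t0 : R),
    [/\ simple_curve_to_infinity g, range g = M, g t0 = p &
    exists A B : set (plane R),
      [/\ sides L A, sides L B, A <> B,
          \forall t \near t0^'-, A (g t) &
          \forall t \near t0^'+, B (g t)]].

(* For pseudolines meeting only at [p] the two conjuncts are equivalent (by the
   Jordan-Schoenflies theorem); both are kept to make the notion symmetric. *)
Definition cross_at (R : realType) (L M : set (plane R)) (p : plane R) : Prop :=
  changes_side L M p /\ changes_side M L p.

(* Distinct indices carry distinct curves, since a pseudoline has infinitely
   many points; so the family is a finite collection of curves. *)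
Record pseudoline_arrangement (R : realType) (I : finType)
    (L : I -> set (plane R)) : Prop := PseudolineArrangement {
  arr_pseudoline : forall i, pseudoline (L i);
  arr_meet : forall i j, i != j ->
    L i `&` L j = set0 \/
    exists2 p, L i `&` L j = [set p] & cross_at (L i) (L j) p;
  arr_general_position : forall i j l, i != j -> i != l -> j != l ->
    L i `&` L j `&` L l = set0
}.

(* [H i] is the selected side of [L i]. *)
Definition pseudohalfplane_arrangement (R : realType) (I : finType)
    (L H : I -> set (plane R)) : Prop :=
  pseudoline_arrangement L /\ forall i, sides (L i) (H i).

(* The (indices of the) pseudohalfplanes that contain [p]. *)
Definition containing (R : realType) (I : finType) (H : I -> set (plane R))
    (p : plane R) : {set I} :=
  [set i | p \in H i]%SET.

(* Main.v *)
(* Idea. Each side of a pseudoline is connected, and a second pseudoline meets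
   it in a ray, entirely, or not at all. When a connected set is the union of
   two closed pieces with connected intersection, both pieces are connected;
   hence all finite intersections of closed sides are connected. This
   "convexity" replaces the Jordan curve theorem. By induction on [k] it
   suffices to find a set [T] of pseudohalfplanes that covers every point of
   depth at least [m] and whose removal leaves each such point at depth at least
   [m - 3].
   If the pseudohalfplanes cover the plane, three of them do (Helly). Otherwise
   every point can be moved towards an uncovered point, leaving one or two
   pseudohalfplanes at a time and entering none, so that only points [q] of
   depth [m] or [m + 1] matter. Let [T] be a minimal set of pseudohalfplanes on
   the boundary of the uncovered region that covers all points of depth at least
   [m]; each member [t] of [T] has a point [p t] of depth at least [m] that is
   in no other member of [T]. If three members [l], [t], [r] of [T] contained
   [q], with [t] the middle one, then every pseudohalfplane containing [p t]
   would contain [q], since the curve of an exception would be trapped in the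
   bounded triangle formed by [l], [t] and [r]. Hence [p t] would have depth at
   most [m + 1 - 2], a contradiction. *)

Require Import Defs.
From HB Require Import structures.
From mathcomp Require Import all_boot all_order all_algebra.
From mathcomp Require Import all_classical all_reals all_analysis.
From mathcomp Require Import ring lra zify.

Set Implicit Arguments.
Unset Strict Implicit.
Unset Printing Implicit Defensive.

Import Order.TTheory GRing.Theory Num.Theory.
Import numFieldNormedType.Exports.

Local Open Scope classical_set_scope.
Local Open Scope ring_scope.

(** * Connectedness through closed sets, and connected subsets of normed spaces *)

Lemma connected_closedP (T : topologicalType) (A : set T) :
  connected A <-> forall F G, closed F -> closed G -> A `<=` F `|` G ->
    (forall x, A x -> F x -> ~ G x) -> A `<=` F \/ A `<=` G.
Proof.
split=> [Ac F G cF cG AFG FG|H B [x Bx] [C oC eC] [D cD eD]].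
  have [AF0|/set0P AF0] := eqVneq (A `&` F) set0.
    right=> x Ax; have [Fx|//] := AFG x Ax.
    by have := conj Ax Fx; rewrite -[_ /\ _]/((A `&` F) x) AF0.
  left; rewrite -[X in X `<=` _](_ : A `&` F = A) ?subIsetr//.
  apply: Ac => //; last by exists F.
  exists (~` G); first exact: closed_openC.
  apply/seteqP; split=> x [Ax Fx]; split=> //; first exact: FG.
  by have [] := AFG x Ax.
have [||AD|AC] := H D (~` C) cD (open_closedC oC).
- by move=> y Ay; have [Cy|] := pselect (C y); 
    [left; have : B y by rewrite eC|right];
    rewrite ?eD => // -[].
- move=> y Ay Dy Cy; apply: Cy.
  by have : B y by [rewrite eD]; rewrite eC => -[].
- rewrite eD; apply/seteqP; split=> y; first by case.
  by move=> Ay; split=> //; exact: AD.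
- by move: Bx; rewrite eC => -[/AC].
Qed.

(** If closed sets [F] and [G] split the part of [K] in [P], the connected overlap with [Q] lies in
    one of them, say [F]. Then [G] within [P], against [Q] together with [F] within [P], splits [K]
    itself. *)
Lemma connected_setI_closed (T : topologicalType) (K P Q : set T) :
  closed P -> closed Q -> connected K -> K `<=` P `|` Q ->
  connected (K `&` P `&` Q) -> connected (K `&` P).
Proof.
move=> cP cQ /connected_closedP Kc KPQ /connected_closedP PQc.
apply/connected_closedP => F G cF cG KFG FG.
wlog PQF : F G cF cG KFG FG / K `&` P `&` Q `<=` F.
  move=> wl; have [| |PQF|PQG] := PQc F G cF cG.
  - by move=> x [/KFG].
  - by move=> x [/FG].
  - exact: wl.
  - rewrite or_comm; apply: wl => //; first by rewrite setUC.
    by move=> x Kx Gx Fx; apply: (FG x).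
have [||||KGP|KQ] := Kc (G `&` P) (Q `|` F `&` P).
- exact: closedI.
- by apply: closedU => //; exact: closedI.
- move=> x Kx; have [Px|Qx] := KPQ x Kx; last by right; left.
  by have [//|Fx|Gx] := KFG x; [right; right|left].
- move=> x Kx [Gx Px] [Qx|[Fx _]]; apply: (FG x) => //.
  exact: PQF.
- by right=> x [/KGP[]].
- left=> x [Kx Px]; have [Qx|[]//] := KQ x Kx.
  exact: PQF.
Qed.

Lemma connected_convex (R : realType) (V : normedModType R) (A : set V) :
  (forall x y t, A x -> A y -> 0 <= t <= 1 -> A (x + t *: (y - x))) ->
  connected A.
Proof.
move=> Acvx; have [->|/set0P[x Ax]] := eqVneq A set0; first exact: connected0.
rewrite (_ : A = \bigcup_(y in A) ((fun t : R => x + t *: (y - x)) @` `[0, 1])).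
  apply: bigcup_connected.
    by exists x => y Ay; exists 0; rewrite ?scale0r ?addr0//=
      in_itv/= lexx ler01.
  move=> y Ay; apply: connected_continuous_connected.
    by apply/connected_intervalP; exact: interval_is_interval.
  apply: continuous_subspaceT => t.
  by apply: cvgD; [exact: cvg_cst|apply: cvgZr_tmp].
apply/seteqP; split=> [y Ay|z [y Ay [t]]].
  by exists y => //; exists 1; rewrite ?scale1r ?subrKC//= in_itv/= lexx ler01.
by rewrite /= in_itv/= => t01 <-; exact: Acvx.
Qed.

Lemma connected_ball (R : realType) (V : normedModType R) (x : V) e :
  connected (ball x e).
Proof.
apply: connected_convex => y z t; rewrite -ball_normE /ball_/=.
move=> xy xz /andP[t0 t1].
rewrite (_ : _ - _ = (1 - t) *: (x - y) + t *: (x - z)); last first.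
  rewrite scalerBl scale1r -addrA [- _ + _]addrC -scalerBr [in RHS]opprB.
  by rewrite [_ - z + _]addrC subrKA opprD addrA -scalerN opprB.
rewrite (le_lt_trans (ler_normD _ _))// !normrZ.
rewrite ger0_norm ?subr_ge0// ger0_norm//.
have [am bm] : `|x - y| <= Num.max `|x - y| `|x - z| /\
    `|x - z| <= Num.max `|x - y| `|x - z|.
  by rewrite !le_max !lexx orbT.
have : Num.max `|x - y| `|x - z| < e by rewrite gt_max xy.
by apply: le_lt_trans; nra.
Qed.

Lemma open_connected_component (R : realType) (V : normedModType R)
  (U : set V) x : open U -> open (connected_component U x).
Proof.
move=> oU; rewrite openE => y Uxy; rewrite /interior.
have Uy : U y by exact: connected_component_sub Uxy.
have /nbhs_ballP[e e0 yeU] : nbhs y U by exact: open_nbhs_nbhs.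
apply/nbhs_ballP; exists e => // z yez.
apply: connected_component_trans Uxy _.
apply: connected_component_max yeU _ _ yez; first exact: ballxx.
exact: connected_ball.
Qed.

(** In the maximum norm the exterior is a union of four half-planes, and each one added meets those
    before it. *)
Lemma connected_exterior (R : realType) (M : R) :
  0 <= M -> connected [set x : plane R | M < `|x|].
Proof.
move=> M0.
have cvx (f : plane R -> R) :
    (forall x y t, f (x + t *: (y - x)) = f x + t * (f y - f x)) ->
    connected [set x | M < f x].
  move=> fE; apply: connected_convex => x y t /= fx fy /andP[t0 t1].
  have [mx my] : Num.min (f x) (f y) <= f x /\ Num.min (f x) (f y) <= f y.
    by rewrite !ge_min !lexx orbT.
  have : M < Num.min (f x) (f y) by rewrite lt_min fx.
  by rewrite fE => /lt_le_trans; apply; nra.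
rewrite (_ : [set x | _] = (([set x | M < x.1] `|` [set x | M < x.2]) `|`
   [set x | M < - x.1]) `|` [set x | M < - x.2]).
  apply: connectedU; [|apply: connectedU; [|apply: connectedU|]|].
  - by exists (M + 1, - (M + 1)); split=> /=; [left; left|]; rewrite /=; lra.
  - by exists (- (M + 1), M + 1); split=> /=; [right|]; rewrite /=; lra.
  - by exists (M + 1, M + 1); split=> /=; lra.
  - by apply: cvx.
  - by apply: cvx.
  - by apply: cvx => x y t /=; rewrite /GRing.scale/=; ring.
  - by apply: cvx => x y t /=; rewrite /GRing.scale/=; ring.
apply/seteqP; split=> x /=; rewrite prod_normE/= lt_max !ltr_normr.
  by move=> /orP[/orP[]|/orP[]] ?;
    [left; left; left|left; right|left; left; right|right].
by move=> [[[|]|]|] ->; rewrite ?orbT.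
Qed.

(** * Curves with both ends at infinity *)

Section curve.
Context {R : realType} {g : R -> plane R}.
Hypothesis gP : simple_curve_to_infinity g.

Lemma curve_unbounded M : exists t, M < `|g t|.
Proof.
have [_ _ _ gy] := gP.
by have [t] := filter_ex (cvgry_gt gy M); exists t.
Qed.

Lemma curve_far M : exists N, forall t, N < `|t| -> M < `|g t|.
Proof.
have [_ _ gNy gy] := gP.
have [a [ar aP]] := cvgry_gt gNy M.
have [b [br bP]] := cvgry_gt gy M.
exists (Num.max (- a) b) => t; rewrite gt_max => /andP[].
have [t0 _ bt|t0 tNa _] := ger0P t; first exact: bP.
by apply: aP; rewrite -ltrN2.
Qed.

Lemma closed_curve : closed (range g).
Proof.
have [gc _ _ _] := gP.
move=> x; have [N NP] := curve_far (`|x| + 1).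
have gNc : closed (g @` `[- N, N]).
  apply: compact_closed; first exact: norm_hausdorff.
  apply: continuous_compact; first exact: continuous_subspaceT.
  exact: segment_compact.
move=> xg; suff /gNc[t _ <-] : closure (g @` `[- N, N]) x by exists t.
move=> B xB; have [|_ [[t _ <-] [Bt xt]]] := xg (B `&` ball x 1).
  by apply: filterI => //; exact: nbhsx_ballx.
exists (g t); split=> //; exists t => //=; rewrite in_itv/= -ler_norml leNgt.
apply/negP => /NP; apply/negP; rewrite -leNgt.
move: xt; rewrite -ball_normE/= distrC => /ltW xt.
rewrite -[g t](subrK x) addrC; apply: le_trans (ler_normD _ _) _.
by rewrite lerD2l.
Qed.

End curve.

(** Helly in dimension one. With [f] a chosen common point for each pair and [m i] the least of the
    [f (i, j)], the largest value [m a] works: [m i <= m a <= f (a, i)], and both ends are in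
    [A i]. *)
Lemma interval_helly (R : realType) (I : finType) (J : {set I})
    (A : I -> set R) :
  (forall i, i \in J -> is_interval (A i)) ->
  (forall i j, i \in J -> j \in J -> exists x, A i x /\ A j x) ->
  exists x, forall i, i \in J -> A i x.
Proof.
move=> Aitv Ameet; have [->|[j0 j0J]] := set_0Vmem J.
  by exists 0 => i; rewrite inE.
have [f fP] : exists f : I * I -> R, forall e, e.1 \in J -> e.2 \in J ->
    A e.1 (f e) /\ A e.2 (f e).
  suff /choice[f fP] : forall e : I * I, exists x, e.1 \in J -> e.2 \in J ->
    A e.1 x /\ A e.2 x by exists f.
  move=> e.
  have [iJ|iJ] := boolP (e.1 \in J); last by exists 0.
  have [jJ|jJ] := boolP (e.2 \in J); last by exists 0.
  by have [x] := Ameet _ _ iJ jJ; exists x.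
have mP i : i \in J -> exists m, (exists2 j, j \in J & m = f (i, j)) /\
    forall j, j \in J -> m <= f (i, j).
  move=> iJ; have [j jJ jmin] := 
    @arg_minP _ _ _ j0 (mem J) (fun j => f (i, j)) j0J.
  by exists (f (i, j)); split=> //; exists j.
have [m {}mP] : exists m : I -> R, forall i, i \in J ->
    (exists2 j, j \in J & m i = f (i, j)) /\
    forall j, j \in J -> m i <= f (i, j).
  suff /choice[m mE] : forall i, exists m, i \in J ->
      (exists2 j, j \in J & m = f (i, j)) /\ forall j, j \in J -> m <= f (i, j).
    by exists m.
  move=> i.
  have [iJ|iJ] := boolP (i \in J); last by exists 0.
  by have [m mi] := mP _ iJ; exists m.
have [a aJ amax] := @arg_maxP _ _ _ j0 (mem J) m j0J.
exists (m a) => i iJ; have [[j jJ mij] _] := mP _ iJ.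
apply: (Aitv i iJ (f (i, j)) (f (a, i))).
- by have [] := fP (i, j) iJ jJ.
- by have [] := fP (a, i) aJ iJ.
- rewrite -mij; apply/andP; split; first exact: amax.
  by have [_] := mP _ aJ; apply.
Qed.

(** * Arrangements with two open sides per curve *)

(** All that the combinatorial argument retains of the arrangement: [true] names the selected side
    of a curve, [false] the opposite one. *)
Record sided_arrangement (R : realType) (I : finType) (g : I -> R -> plane R)
    (O : I -> bool -> set (plane R)) : Prop := SidedArrangement {
  sided_curve : forall i, simple_curve_to_infinity (g i);
  sided_open : forall i b, open (O i b);
  sided_partition : forall i b x,
    O i b x <-> ~ O i (~~ b) x /\ ~ range (g i) x;
  (* Each closed side of [j] cuts the curve [i] in a ray, in the whole curve or
     not at all; all three cases are sign conditions on an affine function. *)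
  sided_affine : forall i j, i != j -> exists m c : R,
    [/\ (m != 0) || (c != 0),
      forall t, O j true (g i t) <-> 0 < m * t + c &
      forall t, O j false (g i t) <-> m * t + c < 0];
  sided_general : forall i j k x, i != j -> i != k -> j != k ->
    range (g i) x -> range (g j) x -> range (g k) x -> False
}.

(** The sign of the product says that [u] is between [s] and [t] without fixing which of the two is
    smaller; the curves below carry no preferred orientation. *)
Lemma interval_between (R : realType) (A : set R) s t u :
  is_interval A -> A s -> A t -> (s - u) * (t - u) <= 0 -> A u.
Proof.
move=> iA As At stu; have [su|us] := leP s u; have [tu|ut] := leP t u.
- have /eqP : (s - u) * (t - u) = 0 by nra.
  by rewrite mulf_eq0 !subr_eq0 => /orP[]/eqP <-.
- by apply: (iA _ _ As At); rewrite su ltW.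
- by apply: (iA _ _ At As); rewrite tu ltW.
- by exfalso; nra.
Qed.

Section sided_arrangement.
Context {R : realType} {I : finType}.
Variables (g : I -> R -> plane R) (O : I -> bool -> set (plane R)).
Hypothesis gO : sided_arrangement g O.

Local Notation L i := (range (g i)).

(** Since [F i false] is the complement of [O i true], it reads as: not covered by [i], points of
    the curve included. *)
Definition closed_side i b : set (plane R) := ~` O i (~~ b).
Local Notation F := closed_side.

Implicit Types (i j k a : I) (b : bool) (x y : plane R).
Implicit Types (s : seq (I * bool)) (J : {set I}).

Lemma open_side_curve i b x : O i b x -> ~ L i x.
Proof. by case/(sided_partition gO). Qed.

Lemma curve_closed_side i b x : L i x -> F i b x.
Proof. by move=> Lx /open_side_curve. Qed.

Lemma open_closed_side i b x : O i b x -> F i b x.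
Proof. by case/(sided_partition gO). Qed.

Lemma closed_side_cases i b x : F i b x -> O i b x \/ L i x.
Proof.
move=> Fx; have [Lx|Lx] := pselect (L i x); [by right|left].
by apply/(sided_partition gO).
Qed.

Lemma closed_sideN i b x : ~ F i b x -> O i (~~ b) x.
Proof. by move/contrapT. Qed.

Lemma closed_side2 i b x : F i b x -> F i (~~ b) x -> L i x.
Proof. by move=> /closed_side_cases[|//] Ox []; rewrite negbK. Qed.

Lemma closed_sideT i b x : F i b x \/ F i (~~ b) x.
Proof.
have [|/closed_sideN/open_closed_side] := pselect (F i b x); first by left.
by right.
Qed.

Lemma closed_sideNE i b x : F i (~~ b) x = ~ O i b x.
Proof. by rewrite /closed_side negbK. Qed.

Lemma closed_closed_side i b : closed (F i b).
Proof. by apply: open_closedC; exact: sided_open gO _ _. Qed.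

Lemma side_affine i j b : i != j -> exists m c : R,
  [/\ (m != 0) || (c != 0),
    forall t, O j b (g i t) <-> 0 < m * t + c &
    forall t, F j b (g i t) <-> 0 <= m * t + c].
Proof.
move=> /(sided_affine gO)[m [c [mc Op On]]]; case: b.
  exists m, c; split=> // t; rewrite leNgt; split.
    by move=> Ft; apply/negP => /On.
  by move=> /negP + /On.
exists (- m), (- c); split; rewrite ?oppr_eq0// => t; rewrite mulNr -opprD.
  by rewrite oppr_gt0.
rewrite oppr_ge0 leNgt; split.
  by move=> Ft; apply/negP => /Op.
by move=> /negP + /Op.
Qed.

Lemma interval_open_side i j b : is_interval [set t | O j b (g i t)].
Proof.
have [<- u v /= Ou|ij u v /=] := eqVneq i j.
  by case: (open_side_curve Ou); exists u.
have [m [c [_ OE _]]] := side_affine b ij.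
rewrite !OE => Ou Ov w /andP[uw wv]; rewrite OE.
by have [m0|m0] := leP 0 m; nra.
Qed.

Lemma interval_closed_side i j b : is_interval [set t | F j b (g i t)].
Proof.
have [<- u v _ _ w _ /=|ij u v /=] := eqVneq i j.
  by apply: curve_closed_side; exists w.
have [m [c [_ _ FE]]] := side_affine b ij.
rewrite !FE => Ou Ov w /andP[uw wv]; rewrite FE.
by have [m0|m0] := leP 0 m; nra.
Qed.

Lemma affine_root_slope (m c t : R) : (m != 0) || (c != 0) -> 
  m * t + c = 0 -> m != 0.
Proof.
by case: eqP => //= -> c0; rewrite mul0r add0r => e; rewrite e eqxx in c0.
Qed.

(** The affine function of [j] along curve [i] vanishes at [u], so its values at [v] and [t] are
    [m * (v - u)] and [m * (t - u)]; their product compares the signs. *)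
Lemma closed_side_same i j b u v t : i != j -> L j (g i u) ->
  O j b (g i v) -> F j b (g i t) -> 0 <= (v - u) * (t - u).
Proof.
move=> ij Lu Ov Ft; have [m [c [mc OE FE]]] := side_affine b ij.
move: Ov Ft; rewrite OE FE => Ov Ft.
have : F j b (g i u) by exact: curve_closed_side.
have : ~ O j b (g i u) by move/open_side_curve.
rewrite FE OE => /negP; rewrite -leNgt => h1 h2.
have e : m * u + c = 0 by lra.
have : 0 <= m ^+ 2 * ((v - u) * (t - u)).
  rewrite (_ : _ * _ =
    (m * v + c - (m * u + c)) * (m * t + c - (m * u + c))); last by ring.
  by rewrite e !subr0 mulr_ge0// ltW.
rewrite pmulr_rge0// lt_neqAle sqr_ge0 andbT eq_sym expf_eq0/=.
exact: affine_root_slope mc e.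
Qed.

Lemma closed_side_opp i j b u v t : i != j -> L j (g i u) ->
  F j b (g i v) -> F j (~~ b) (g i t) -> (v - u) * (t - u) <= 0.
Proof.
move=> ij Lu Fv Ft; have [m [c [mc OE FE]]] := side_affine b ij.
move: Fv Ft; rewrite closed_sideNE OE FE => Fv /negP.
rewrite -leNgt => Ft.
have : F j b (g i u) by exact: curve_closed_side.
have : ~ O j b (g i u) by move/open_side_curve.
rewrite FE OE => /negP; rewrite -leNgt => h1 h2.
have e : m * u + c = 0 by lra.
have : m ^+ 2 * ((v - u) * (t - u)) <= 0.
  rewrite (_ : _ * _ =
    (m * v + c - (m * u + c)) * (m * t + c - (m * u + c))); last by ring.
  by rewrite e !subr0 mulr_ge0_le0.
rewrite pmulr_rle0// lt_neqAle sqr_ge0 andbT eq_sym expf_eq0/=.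
exact: affine_root_slope mc e.
Qed.

Lemma closed_side_cross i j b v t : i != j ->
  F j b (g i v) -> F j (~~ b) (g i t) -> exists u, L j (g i u).
Proof.
move=> ij Fv Ft; have [m [c [mc OE FE]]] := side_affine b ij.
move: Fv Ft; rewrite closed_sideNE OE FE => Fv /negP.
rewrite -leNgt => Ft.
have m0 : m != 0.
  case/orP: mc => // /eqP c0; apply/eqP => m0; apply: c0.
  move: Fv Ft; rewrite m0 !mul0r !add0r => h1 h2.
  by apply/le_anti; rewrite h1 h2.
exists (- c / m); apply: (@closed_side2 _ b).
  by rewrite FE mulrC mulfVK// addNr.
by rewrite closed_sideNE OE mulrC mulfVK// addNr ltxx.
Qed.

(** * Cells: finite intersections of closed sides *)

Definition cell s : set (plane R) := [set x | forall e, e \in s -> F e.1 e.2 x].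

Lemma cell_cons e s : cell (e :: s) = cell s `&` F e.1 e.2.
Proof.
apply/seteqP; split=> x.
  move=> h; split; first by move=> f fs; apply: h; rewrite in_cons fs orbT.
  by apply: h; rewrite mem_head.
by move=> [h1 h2] f; rewrite in_cons => /predU1P[->|/h1].
Qed.

Lemma closed_cell s : closed (cell s).
Proof.
elim: s => [|e s IH].
  by rewrite (_ : cell [::] = setT); [exact: closedT|apply/seteqP].
by rewrite cell_cons; apply: closedI => //; exact: closed_closed_side.
Qed.

(** The two closed sides of [i] cut a cell into pieces that meet in the part of curve [i] inside the
    cell. That part is the image of an interval, so [connected_setI_closed] applies. *)
Lemma connected_cell s : connected (cell s).
Proof.
elim: s => [|[i b] s IH].
  by rewrite (_ : cell [::] = setT); [exact: connected_convex|apply/seteqP].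
rewrite cell_cons/=; apply: (@connected_setI_closed _ _ _ (F i (~~ b))) => //.
- exact: closed_closed_side.
- exact: closed_closed_side.
- by move=> x _; exact: closed_sideT.
rewrite (_ : _ `&` _ = g i @` [set t | cell s (g i t)]).
  apply: connected_continuous_connected.
    apply/connected_intervalP => u v su sv w uvw /= e es.
    by apply: interval_closed_side uvw; [exact: su|exact: sv].
  by apply: continuous_subspaceT; have [] := sided_curve gO i.
apply/seteqP; split=> [x [[sx Fx] Fx']|_ [t /= st <-]].
  by have [t _ tx] := closed_side2 Fx Fx'; exists t => //=; rewrite tx.
by split; [split=> //|]; apply: curve_closed_side; exists t.
Qed.

Lemma connected_meets_curve A i b x y : connected A -> A x -> A y ->
  F i b x -> F i (~~ b) y -> exists2 z, A z & L i z.
Proof.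
move=> /connected_closedP Ac Ax Ay Fx Fy.
apply: contrapT => nA.
have Az z : A z -> ~ L i z by move=> Az Lz; apply: nA; exists z.
have [||z Az'|z Az' /closed_side2 h/h/Az|h|h] := Ac (F i b) (F i (~~ b)).
- exact: closed_closed_side.
- exact: closed_closed_side.
- exact: closed_sideT.
- by [].
- by apply: (Az y) => //; apply: closed_side2 Fy; exact: h.
- by apply: (Az x) => //; apply: closed_side2 Fx _; exact: h.
Qed.

Lemma cell_meets_curve s i b x y : cell s x -> cell s y ->
  F i b x -> F i (~~ b) y -> exists t, cell s (g i t).
Proof.
move=> sx sy Fx Fy.
have [z sz [t _ tz]] := connected_meets_curve (@connected_cell s) sx sy Fx Fy.
by exists t; rewrite tz.
Qed.

Lemma cell1P i b x : cell [:: (i, b)] x <-> F i b x.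
Proof.
by rewrite cell_cons; split=> [[]//|Fx]; split=> // e; rewrite in_nil.
Qed.

Lemma cell2P i b j c x : cell [:: (i, b); (j, c)] x <-> F i b x /\ F j c x.
Proof.
by rewrite cell_cons; split=> [[/cell1P]//|[Fi Fj]]; split=> //; apply/cell1P.
Qed.

Lemma cell3P i b j c k d x : cell [:: (i, b); (j, c); (k, d)] x <->
  [/\ F i b x, F j c x & F k d x].
Proof.
rewrite cell_cons; split=> [[/cell2P[]]//|[Fi Fj Fk]].
by split=> //; apply/cell2P.
Qed.

(** * Triangles formed by three curves *)

(** In the cell of [F r true] and [F a false], curve [t] separates [y] from [q], so it has a point
    [w] there. On curve [t] the crossing [Q] is between [x] and [w], both outside [a]. *)
Lemma corner t r a x y q Q : t != r -> t != a -> r != a ->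
  L t x -> F r false x -> F a false x ->
  L r y -> F t false y -> F a false y ->
  O r true q -> O t true q -> F a false q ->
  L t Q -> L r Q -> O a false Q.
Proof.
move=> tr ta ra [u _ ux] rx ax Ly ty ay rq tq aq [v _ vQ] LrQ.
rewrite -[false]/(~~ true); apply: closed_sideN => aQ.
have {}aQ : O a true Q.
  have [//|LaQ] := closed_side_cases aQ.
  by case: (sided_general gO tr ta ra _ LrQ LaQ); exists v.
have ry : cell [:: (r, true); (a, false)] y.
  by apply/cell2P; split=> //; exact: curve_closed_side.
have rq' : cell [:: (r, true); (a, false)] q.
  by apply/cell2P; split=> //; exact: open_closed_side.
have [w /cell2P[rw aw]] := cell_meets_curve ry rq' ty (open_closed_side tq).
have av : F a false (g t v).
  apply: (interval_between (@interval_closed_side t a false)); last first.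
  - apply: (closed_side_opp (b := true)) tr _ rw _; rewrite ?vQ//.
    by rewrite -ux in rx; exact: rx.
  - by rewrite /= ux.
  - exact: aw.
by apply: av; rewrite vQ.
Qed.

(** The conditions from [j] and [k] cut curve [i] down to the segment between its crossings with
    them, and both ends are outside [a]. *)
Lemma segment_avoids i j k a bj bk u v : i != j -> i != k ->
  L j (g i u) -> L k (g i v) -> O k bk (g i u) -> O j bj (g i v) ->
  O a false (g i u) -> O a false (g i v) ->
  forall t, F j bj (g i t) -> F k bk (g i t) ->
    O a false (g i t) /\ (u - t) * (v - t) <= 0.
Proof.
move=> ij ik Lj Lk Ok Oj au av t Ft Kt.
have h1 := closed_side_same ij Lj Oj Ft.
have h2 := closed_side_same ik Lk Ok Kt.
have uv : u != v.
  by apply: contra_notN (open_side_curve Ok) => /eqP ->.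
(* By [h1], [t] is on the same side of [u] as [v]; by [h2], on the same side of [v] as [u]. The
   product of the two puts [t] in between. *)
have ut : (u - t) * (v - t) <= 0.
  have := mulr_ge0 h1 h2.
  rewrite (_ : _ * _ = - ((v - u) ^+ 2 * ((u - t) * (v - t)))); last by ring.
  by rewrite oppr_ge0 pmulr_rle0// exprn_even_gt0//= subr_eq0 eq_sym.
by split=> //; exact: (interval_between (@interval_open_side i a false)) ut.
Qed.

Lemma bounded_arc i u v :
  exists M, forall t, (u - t) * (v - t) <= 0 -> `|g i t| <= M.
Proof.
wlog uv : u v / u <= v.
  move=> wl; have [/wl//|/ltW/wl[M MP]] := leP u v.
  by exists M => t; rewrite mulrC; exact: MP.
have : bounded_set (g i @` `[u, v]).
  apply: compact_bounded.
  apply: continuous_compact; last exact: segment_compact.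
  by apply: continuous_subspaceT; have [] := sided_curve gO i.
case=> M [_ MP]; exists (M + 1) => t ut; apply: MP; first by rewrite ltrDl.
exists t => //=; rewrite in_itv/=.
by apply/andP; split; rewrite leNgt; apply/negP => h; nra.
Qed.

(** The triangle is the cell of [F t true], [F l false] and [F r false]. Its side on [r] runs from
    the corner [Q] to the crossing of [r] and [l]; the work is to find that third corner and to show
    that it is outside [a]. *)
Lemma triangle_side t l r a q P Q : 
  t != l -> t != r -> t != a -> l != r -> l != a -> r != a ->
  O t true q -> O l true q -> O r true q -> F a false q ->
  L t P -> L l P -> O r false P -> O a false P ->
  L t Q -> L r Q -> O l false Q -> O a false Q ->
  exists M, forall u, F t true (g r u) -> F l false (g r u) ->
    O a false (g r u) /\ `|g r u| <= M.
Proof.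
move=> tl tr ta lr la ra tq lq rq aq tP lP rP aP tQ [u0 _ u0Q] lQ aQ.
have [rt rl] : r != t /\ r != l by rewrite ![r == _]eq_sym.
have tlP : cell [:: (t, true); (l, true)] P.
  by apply/cell2P; split; apply: curve_closed_side.
have tlq : cell [:: (t, true); (l, true)] q.
  by apply/cell2P; split; apply: open_closed_side.
(* Curve [r] separates [P] from [q], so it enters the cell of [t] and [l]; as [Q] is outside [l], it
   crosses [l] between [Q] and [y]. *)
have [y /cell2P[ty ly]] :=
  cell_meets_curve tlP tlq (open_closed_side rP) (open_closed_side rq).
have lu0 : F l false (g r u0) by rewrite u0Q; exact: open_closed_side.
have [y1 Ly1] := closed_side_cross rl lu0 ly.
have ty1 : O t true (g r y1).
  have u0y : (u0 - y1) * (y - y1) <= 0 by exact: closed_side_opp lu0 ly.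
  have tu0 : F t true (g r u0) by apply: curve_closed_side; rewrite u0Q.
  have [//|Lt] := closed_side_cases
    (interval_between (@interval_closed_side r t true) tu0 ty u0y).
  by case: (sided_general gO tl tr lr Lt Ly1); exists y1.
have ay1 : O a false (g r y1).
  rewrite -[false]/(~~ true); apply: closed_sideN => ay1.
  have {}ay1 : O a true (g r y1).
    have [//|La] := closed_side_cases ay1.
    by case: (sided_general gO lr la ra Ly1 _ La); exists y1.
  (* The same search inside [F a false] yields a point [s] of [r] outside [a] such that [y1] is
     between [u0] and [s]. *)
  have atlP : cell [:: (a, false); (t, true); (l, true)] P.
    apply/cell3P; split; first exact: open_closed_side.
      exact: curve_closed_side.
    exact: curve_closed_side.
  have atlq : cell [:: (a, false); (t, true); (l, true)] q.
    by apply/cell3P; split; [|exact: open_closed_side..].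
  have [s /cell3P[sa st sl]] :=
    cell_meets_curve atlP atlq (open_closed_side rP) (open_closed_side rq).
  have u0s : (u0 - y1) * (s - y1) <= 0 by exact: closed_side_opp lu0 sl.
  have au0 : F a false (g r u0) by rewrite u0Q; exact: open_closed_side.
  by case: (interval_between (@interval_closed_side r a false) au0 sa u0s).
have [M MP] := bounded_arc r u0 y1.
exists M => u tu lu.
have [|||h /MP] :=
  @segment_avoids r t l a true false u0 y1 rt rl _ Ly1 _ ty1 _ ay1 u tu lu.
- by rewrite u0Q.
- by rewrite u0Q.
- by rewrite u0Q.
- by [].
Qed.

(** A point outside the cell is in some opposite closed side. These form a closed finite union [G],
    which meets the cell only on its boundary curves. *)
Lemma connected_in_cell A s : connected A ->
  (forall e x, e \in s -> A x -> cell s x -> ~ L e.1 x) ->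
  A `<=` cell s \/ (forall x, A x -> ~ cell s x).
Proof.
move=> /connected_closedP Ac AL.
pose G := \bigcup_(e in [set` s]) F e.1 (~~ e.2).
have [|||x Ax sx [e es Ge]|h|h] := Ac (cell s) G.
- exact: closed_cell.
- apply: closed_bigcup; first exact: finite_seq.
  by move=> e _; exact: closed_closed_side.
- move=> x Ax; have [?|/existsNP[e /not_implyP[es Fe]]] := pselect (cell s x).
    by left.
  by right; exists e => //; apply/open_closed_side/closed_sideN.
- by apply: (AL e x) => //; apply: closed_side2 Ge; exact: sx.
- by left.
- right=> x Ax sx; have [e es Ge] := h x Ax.
  by apply: (AL e x) => //; apply: closed_side2 Ge; exact: sx.
Qed.

(* Outside a large disc the boundary of the cell is absent, so that the cell is
   bounded; and it contains the whole curve [a] if [F a true] avoids its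
   boundary. *)
Lemma no_side_in_bounded_cell s a M p : s != [::] ->
  (forall e u, e \in s -> cell s (g e.1 u) ->
     O a false (g e.1 u) /\ `|g e.1 u| <= M) ->
  cell s p -> F a true p -> False.
Proof.
move=> s0 sM sp ap.
have [|e x es /cell1P ax sx [u _ ux]|as_|] :=
  @connected_in_cell (cell [:: (a, true)]) s.
- exact: connected_cell.
- by rewrite -ux in ax sx; have [/ax] := sM _ _ es sx.
- have M0 : 0 <= Num.max 0 M by rewrite le_max lexx.
  have [e0 e0s] : exists e, e \in s.
    by case: s s0 {sM sp as_} => // e s; exists e; rewrite mem_head.
  have [e x es Mx sx [u _ ux]|Es|Es] :=
    @connected_in_cell _ s (connected_exterior M0).
  + rewrite -ux in Mx sx; have [_] := sM _ _ es sx; move: Mx => /=.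
    by rewrite gt_max => /andP[_ /lt_le_trans h /h]; rewrite ltxx.
  + have [u Mu] := curve_unbounded (sided_curve gO e0.1) (Num.max 0 M).
    have [_] := sM _ _ e0s (Es _ Mu).
    by move: Mu; rewrite gt_max => /andP[_ /lt_le_trans h /h]; rewrite ltxx.
  + have [u Mu] := curve_unbounded (sided_curve gO a) (Num.max 0 M).
    by apply: (Es _ Mu); apply/as_/cell1P/curve_closed_side; exists u.
- by move/(_ p); apply; first exact/cell1P.
Qed.

(** The conditions on [P] and [Q] make [t] the middle curve: [P] is outside [r] and [Q] outside [l].
    All three sides of the triangle around [p] are then bounded and outside [a], although [p] is in
    the closed side of [a]. *)
Lemma middle_private_point_absurd t l r a q p xt xl xr P Q :
  t != l -> t != r -> t != a -> l != r -> l != a -> r != a ->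
  O t true q -> O l true q -> O r true q -> F a false q ->
  F t true p -> F l false p -> F r false p -> F a true p ->
  L t xt -> F l false xt -> F r false xt -> F a false xt ->
  L l xl -> F t false xl -> F a false xl ->
  L r xr -> F t false xr -> F a false xr ->
  L t P -> L l P -> O r false P ->
  L t Q -> L r Q -> O l false Q -> False.
Proof.
move=> tl tr ta lr la ra tq lq rq aq tp lp rp ap txt lxt rxt axt lxl txl axl.
move=> rxr txr axr tP lP rP tQ rQ lQ.
have aP : O a false P.
  exact: (corner tl ta la txt lxt axt lxl txl axl lq tq aq).
have aQ : O a false Q.
  exact: (corner tr ta ra txt rxt axt rxr txr axr rq tq aq).
have rl : r != l by rewrite eq_sym.
have [M1 M1P] :=
  triangle_side tl tr ta lr la ra tq lq rq aq tP lP rP aP tQ rQ lQ aQ.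
have [M2 M2P] :=
  triangle_side tr tl ta rl ra la tq rq lq aq tQ rQ lQ aQ tP lP rP aP.
have [u _ uP] := tP; have [v _ vQ] := tQ.
have [M3 M3P] := bounded_arc t u v.
set M := Num.max M1 (Num.max M2 M3).
have [h1 h2 h3] : [/\ M1 <= M, M2 <= M & M3 <= M].
  by rewrite /M !le_max !lexx !orbT.
apply: (@no_side_in_bounded_cell [:: (t, true); (l, false); (r, false)] a M p);
    rewrite //; last first.
  exact/cell3P.
move=> e w; rewrite !inE => /or3P[]/eqP -> /= /cell3P[tw lw rw].
- have [||||||h /M3P h'] :=
      @segment_avoids t l r a false false u v tl tr _ _ _ _ _ _ w lw rw;
    rewrite ?uP ?vQ//.
  by split=> //; apply: le_trans h3.
- have [h h'] := M2P _ tw rw.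
  by split=> //; apply: le_trans h2.
- have [h h'] := M1P _ tw lw.
  by split=> //; apply: le_trans h1.
Qed.

Lemma curves_meet i j q xi xj : i != j -> O i true q -> O j true q ->
  L i xi -> F j false xi -> L j xj -> F i false xj ->
  exists P, L i P /\ L j P.
Proof.
move=> ij iq jq ixi jxi [u _ uxj] ixj.
have c1 : cell [:: (i, true)] xi by apply/cell1P/curve_closed_side.
have c2 : cell [:: (i, true)] q by apply/cell1P/open_closed_side.
have [v /cell1P iv] := cell_meets_curve c1 c2 jxi (open_closed_side jq).
have iu : F i false (g j u) by rewrite uxj.
have [|w iw] := closed_side_cross _ iu iv; first by rewrite eq_sym.
by exists (g j w); split=> //; exists w.
Qed.

(** Otherwise, on curve [i], each of the crossings [P] and [Q] would be between the other one and
    [x], so they would coincide. *)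
Lemma one_crossing_inside i j k x P Q : i != j -> i != k -> j != k ->
  L i x -> F j false x -> F k false x -> L i P -> L j P -> L i Q -> L k Q ->
  O k true P -> ~ O j true Q.
Proof.
move=> ij ik jk [w _ wx] jx kx [u _ uP] jP [v _ vQ] kQ kP jQ.
subst x P Q.
have h1 : (u - v) * (w - v) <= 0.
  by apply: closed_side_opp ik kQ (open_closed_side kP) kx.
have h2 : (v - u) * (w - u) <= 0.
  by apply: closed_side_opp ij jP (open_closed_side jQ) jx.
have uv : u = v by nra.
by subst v; apply: open_side_curve kP kQ.
Qed.

(** Which of the three is the middle one depends on their crossings, so a private point and an
    exception [a] are required for each. *)
Lemma no_three_private_sides l t r q (J : {set I}) :
  l != t -> l != r -> t != r ->
  O l true q -> O t true q -> O r true q ->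
  (forall i, i \in [:: l; t; r] -> i \in J /\
     exists x, L i x /\ forall j, j \in J -> F j false x) ->
  (forall i, i \in [:: l; t; r] -> exists p,
    [/\ O i true p, forall j, j \in [:: l; t; r] -> j != i -> F j false p &
      exists2 a, a \in J & O a true p /\ F a false q]) -> False.
Proof.
move=> lt lr tr lq tq rq xP pP.
have Oq i : i \in [:: l; t; r] -> O i true q by rewrite !inE => /or3P[]/eqP ->.
have sJ i : i \in [:: l; t; r] -> i \in J by case/xP.
(* The contradiction once [i] is known to be the middle curve. General position turns not being in
   the selected side, at [P] and [Q], into being in the opposite open side. *)
have final i j k : [/\ i != j, i != k & j != k] ->
    [/\ i \in [:: l; t; r], j \in [:: l; t; r] & k \in [:: l; t; r]] ->
    forall P Q, L i P -> L j P -> L i Q -> L k Q ->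
    ~ O k true P -> ~ O j true Q -> False.
  move=> [ij ik jk] [il jl kl] P Q iP jP iQ kQ kP jQ.
  have [iJ [xi [ixi xiJ]]] := xP _ il.
  have [jJ [xj [jxj xjJ]]] := xP _ jl.
  have [kJ [xk [kxk xkJ]]] := xP _ kl.
  have [p [ip pl [a aJ [ap aq]]]] := pP _ il.
  have neq_a m : m \in [:: l; t; r] -> m != a.
    by move=> /Oq mq; apply: contra_notN aq => /eqP <-.
  apply: (middle_private_point_absurd ij ik (neq_a _ il) jk (neq_a _ jl)
    (neq_a _ kl)
    (Oq _ il) (Oq _ jl) (Oq _ kl) aq (open_closed_side ip) _ _
    (open_closed_side ap) ixi _ _ _ jxj _ _ kxk _ _ iP jP _ iQ kQ);
    auto.
  - by apply: pl; rewrite // eq_sym.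
  - by apply: pl; rewrite // eq_sym.
  - have [//|kP'] := closed_side_cases (kP : F k false P).
    by case: (sided_general gO ij ik jk iP jP kP').
  - have [//|jQ'] := closed_side_cases (jQ : F j false Q).
    by case: (sided_general gO ij ik jk iQ jQ' kQ).
have [ls ts rs] :
    [/\ l \in [:: l; t; r], t \in [:: l; t; r] & r \in [:: l; t; r]].
  by rewrite !inE !eqxx !orbT.
have [lJ [xl [lxl xlJ]]] := xP _ ls.
have [tJ [xt [txt xtJ]]] := xP _ ts.
have [rJ [xr [rxr xrJ]]] := xP _ rs.
have [tl rl rt] : [/\ t != l, r != l & r != t].
  by rewrite ![_ == l]eq_sym [r == _]eq_sym.
have [A [lA tA]] := curves_meet lt lq tq lxl (xlJ _ tJ) txt (xtJ _ lJ).
have [B [lB rB]] := curves_meet lr lq rq lxl (xlJ _ rJ) rxr (xrJ _ lJ).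
have [C [tC rC]] := curves_meet tr tq rq txt (xtJ _ rJ) rxr (xrJ _ tJ).
(* At most one of the three crossings lies in the third pseudohalfplane; the
   middle curve is the one that does not pass through it. *)
have [rA|rA] := pselect (O r true A).
  apply: (final r l t _ _ _ _ rB lB rC tC) => //.
    exact: (one_crossing_inside lt lr tr lxl (xlJ _ tJ) (xlJ _ rJ)
      lA tA lB rB rA).
  exact: (one_crossing_inside tl tr lr txt (xtJ _ lJ) (xtJ _ rJ)
      tA lA tC rC rA).
have [tB|tB] := pselect (O t true B).
  apply: (final t l r _ _ _ _ tA lA tC rC rA) => //.
  exact: (one_crossing_inside rl rt lt rxr (xrJ _ lJ) (xrJ _ tJ)
      rB lB rC tC tB).
exact: (final l t r _ _ _ _ lA tA lB rB rA tB).
Qed.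

(** * Covered points and a Helly theorem for pseudohalfplanes *)

Definition covering (J : {set I}) x : {set I} :=
  [set i in J | `[< O i true x >]]%SET.

Lemma coveringP J i x : reflect (i \in J /\ O i true x) (i \in covering J x).
Proof.
by rewrite inE; apply: (iffP andP) => -[iJ /asboolP].
Qed.

Lemma notin_covering J i x : i \in J -> i \notin covering J x -> F i false x.
Proof.
move=> iJ; apply: contraNP; rewrite /closed_side/= => /contrapT ix.
exact/coveringP.
Qed.

(** In a minimal cover [T] each member has a private point. With four members, the complements of
    all but [e] would meet pairwise on the curve of [e], so by [interval_helly] some point of that
    curve would be uncovered. *)
Lemma cover_by_three (J : {set I}) : (forall x, covering J x != finset.set0) ->
  exists2 T : {set I}, (T \subset J)%SET &
    (#|T| <= 3)%N /\ forall x, covering T x != finset.set0.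
Proof.
move=> Jcov.
pose P (T : {set I}) := (T \subset J)%SET &&
  `[< forall x, covering T x != finset.set0 >].
have [|T /minsetP[/andP[TJ /asboolP Tcov] Tmin]] := @ex_minset _ P.
  by exists J; rewrite /P subxx; apply/asboolP.
exists T => //; split=> //; rewrite leqNgt; apply/negP => T3.
have priv i : i \in T -> exists x, O i true x /\
    forall j, j \in T -> j != i -> F j false x.
  move=> iT; have : ~ P (T :\ i)%SET.
    by move=> /Tmin/(_ (finset.subsetDl _ _)) e; move: iT; rewrite -e !inE eqxx.
  rewrite /P (fintype.subset_trans (finset.subsetDl _ _) TJ)/=.
  move=> /negP/asboolPn/existsNP[x /negP/negPn/eqP xT].
  have jx j : j \in T -> j != i -> F j false x.
    move=> jT ji; apply: (@notin_covering (T :\ i)); first by rewrite !inE ji.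
    by rewrite xT inE.
  exists x; split=> //; have /set0Pn[j /coveringP[jT Oj]] := Tcov x.
  have [<-//|ji] := eqVneq j i.
  by case: (jx _ jT ji).
have [e eT] : exists e, e \in T.
  by apply/set0Pn; rewrite -card_gt0; apply: leq_trans T3.
have [xe [exe xeT]] := priv _ eT.
have nex : ~ exists t, forall i, i \in (T :\ e)%SET -> F i false (g e t).
  move=> [t tT]; have /set0Pn[i /coveringP[iT it]] := Tcov (g e t).
  have [ie|ie] := eqVneq i e; last by case: (tT i) => //; rewrite !inE ie.
  by apply: (open_side_curve it); rewrite ie; exists t.
apply/nex/(@interval_helly _ _ _ (fun i => [set t | F i false (g e t)])).
  by move=> i _; exact: interval_closed_side.
move=> a b; rewrite !inE => /andP[ae aT] /andP[be bT].
have [d] : exists d, d \in (T :\: [set e; a; b])%SET.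
  apply/set0Pn; rewrite -card_gt0 cardsD subn_gt0; apply: leq_ltn_trans T3.
  apply: leq_trans (subset_leq_card (finset.subsetIr _ _)) _.
  apply: leq_trans (leq_card_setU _ _) _; rewrite cards1 addn1 ltnS.
  by rewrite cards2; case: (_ != _).
rewrite !inE !negb_or => /andP[/andP[/andP[de da] db] dT].
(* The private point of a fourth member [d] is outside [a], [b] and [e]; that of [e] is outside [a]
   and [b] but inside [e]. So curve [e] meets the cell of [a] and [b]. *)
have [xd [_ xdT]] := priv _ dT.
have c1 : cell [:: (a, false); (b, false)] xd.
  by apply/cell2P; split; apply: xdT; rewrite // eq_sym.
have c2 : cell [:: (a, false); (b, false)] xe.
  by apply/cell2P; split; apply: xeT.
have [|t /cell2P tab] :=
  @cell_meets_curve _ e false _ _ c1 c2 _ (open_closed_side exe).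
  by apply: xdT; rewrite // eq_sym.
by exists t.
Qed.

(** * Arrangements that leave a point uncovered *)

Section uncovered.
Variables (J : {set I}) (o : plane R).
Hypothesis oJ : forall i, i \in J -> F i false o.

(** An extremal choice replaces a path from [p] towards [o]: among the points that enter nothing new
    and are outside some member of [S], [x] has a maximal set [D x] of closed sides containing
    it. *)
Lemma covering_shrink p : covering J p != finset.set0 -> exists x,
  [/\ covering J x \proper covering J p,
      (#|covering J p| <= #|covering J x| + 2)%N &
      forall i, i \in covering J p -> F i true x].
Proof.
move=> p0; set S := covering J p.
pose Q x := (forall i, i \in J -> i \notin S -> F i false x) /\
  exists2 i, i \in S & F i false x.
pose D x := [set i in S | `[< F i true x >]]%SET.
pose P (A : {set I}) := `[< exists2 x, Q x & D x = A >].
have [|A /maxsetP[/asboolP[x [xJ [i0 i0S i0x]] DxA] Amax]] := @ex_maxset _ P.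
  exists (D o); apply/asboolP; exists o => //; split=> [i /oJ//|].
  by case/set0Pn: p0 => i iS; exists i => //; apply: oJ; case/coveringP: iS.
pose s := [seq (i, false) | i <- enum (J :\: S)%SET] ++
  [seq (i, true) | i <- enum (D x)].
have sE y : cell s y <-> (forall i, i \in J -> i \notin S -> F i false y) /\
    forall i, i \in D x -> F i true y.
  split=> [sy|[h1 h2] e].
    split=> [i iJ iS|i iD].
      by apply: (sy (i, false)); rewrite mem_cat map_f// mem_enum inE iS.
    by apply: (sy (i, true)); rewrite mem_cat map_f ?orbT// mem_enum.
  rewrite mem_cat => /orP[]/mapP[i]; rewrite mem_enum => h -> /=.
    by move: h; rewrite inE => /andP[iS iJ]; exact: h1.
  exact: h2.
have sx : cell s x.
  by apply/sE; split=> // i; rewrite inE => /andP[_ /asboolP].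
have sp : cell s p.
  apply/sE; split=> [i iJ iS|i]; first exact: notin_covering iS.
  by rewrite inE => /andP[/coveringP[_ /open_closed_side]].
(* If curve [i] separated [x] from [p], it would meet their common cell [s], and by maximality
   adding [i] to [D x] there changes nothing. *)
have xS i : i \in S -> F i true x.
  move=> iS; have [//|ix] := closed_sideT i true x.
  have ip : F i true p by case/coveringP: (iS) => _ /open_closed_side.
  have [t /sE[tJ tD]] := cell_meets_curve sx sp ix ip.
  have iD : i \in D (g i t).
    by rewrite inE iS; apply/asboolP/curve_closed_side; exists t.
  have : D (g i t) = A.
    apply: Amax.
      apply/asboolP; exists (g i t) => //; split=> //.
      by exists i => //; apply: curve_closed_side; exists t.
    rewrite -DxA; apply/fintype.subsetP => j jD; rewrite inE; apply/andP; split.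
      by move: jD; rewrite inE => /andP[].
    exact/asboolP/tD.
  by rewrite -DxA => e; move: iD; rewrite e inE => /andP[_ /asboolP].
have sub : (covering J x \subset S)%SET.
  apply/fintype.subsetP => i /coveringP[iJ ix]; apply: contraT => iS.
  by case: (xJ i iJ iS).
exists x; split=> //.
  rewrite properE sub; apply/fintype.subsetPn; exists i0 => //.
  by apply/negP => /coveringP[_]; exact: i0x.
(* Each member lost has [x] on its curve, and no three curves share a point; so at most two are
   lost. *)
rewrite -(finset.setIidPr sub) -leq_subLR -cardsD leqNgt; apply/negP => h.
have Lx i : i \in (S :\: covering J x)%SET -> L i x.
  rewrite inE => /andP[ix iS].
  have [ox|//] := closed_side_cases (xS i iS).
  by case/negP: ix; apply/coveringP; split=> //; case/coveringP: iS.
have /card_gt2P[a [b [c [[ha hb hc] [ab bc ca]]]]] :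
  (2 < #|S :\: covering J x|)%N by [].
have ac : a != c by rewrite eq_sym.
exact: (sided_general gO ab ac bc (Lx _ ha) (Lx _ hb) (Lx _ hc)).
Qed.

(** One step loses one or two members, so the descent cannot jump over both [m] and [m.+1]. *)
Lemma covering_shrink_to m p :
  (0 < m)%N -> (m <= #|covering J p|)%N -> exists x,
  [/\ (covering J x \subset covering J p)%SET, (m <= #|covering J x|)%N &
      (#|covering J x| <= m.+1)%N].
Proof.
move=> m0; have [n] := ubnP #|covering J p|; elim: n p => // n IH p pn mp.
have [pm|pm] := leqP #|covering J p| m.+1; first by exists p.
have p0 : covering J p != finset.set0 by rewrite -card_gt0; apply: leq_trans mp.
have [x [/[dup] xp /proper_card xpc px _]] := covering_shrink p0.
have [||y [yx my ym]] := IH x; [lia|lia|].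
exists y; split=> //; apply: fintype.subset_trans yx _.
exact: fintype.proper_sub.
Qed.

(** The descent ends at an uncovered [x]. The last step keeps [x] in the closed sides of all members
    that covered the point before, so [x] lies on their curves. *)
Lemma covering_exposed p : covering J p != finset.set0 -> exists i,
  i \in covering J p /\ exists x, L i x /\ forall j, j \in J -> F j false x.
Proof.
have [n] := ubnP #|covering J p|; elim: n p => // n IH p pn p0.
have [x [/[dup] xp /proper_card xpc px xF]] := covering_shrink p0.
have [x0|x0] := eqVneq (covering J x) finset.set0.
  have xJ j : j \in J -> F j false x.
    by move=> jJ; apply: notin_covering jJ _; rewrite x0 inE.
  case/set0Pn: p0 => i ip; exists i; split=> //; exists x; split=> //.
  by apply: closed_side2 (xF i ip) _; apply: xJ; case/coveringP: ip.
have [|i [ix ?]] := IH x _ x0; first by lia.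
by exists i; split=> //; apply: (fintype.subsetP (fintype.proper_sub xp)) ix.
Qed.

Lemma shallow_hitting_uncovered m : (0 < m)%N -> exists2 T : {set I},
  (T \subset J)%SET & forall p, (m <= #|covering J p|)%N ->
    covering T p != finset.set0 /\ (m <= #|covering (J :\: T) p| + 2)%N.
Proof.
move=> m0.
(* The members on the boundary of the uncovered region. *)
pose E := [set i in J |
  `[< exists x, L i x /\ forall j, j \in J -> F j false x >]]%SET.
pose P (T : {set I}) := (T \subset E)%SET &&
  `[< forall p, (m <= #|covering J p|)%N -> covering T p != finset.set0 >].
have EJ : (E \subset J)%SET.
  by apply/fintype.subsetP => i; rewrite inE => /andP[].
have [|T /minsetP[/andP[TE /asboolP Thit] Tmin]] := @ex_minset _ P.
  exists E; rewrite /P subxx; apply/asboolP => p mp.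
  have [|i [/coveringP[iJ ip] ix]] := @covering_exposed p.
    by rewrite -card_gt0; apply: leq_trans mp.
  apply/set0Pn; exists i; apply/coveringP; split=> //.
  by rewrite inE iJ; apply/asboolP.
have TJ := fintype.subset_trans TE EJ.
have priv i : i \in T -> exists p, [/\ (m <= #|covering J p|)%N, O i true p &
    forall j, j \in T -> j != i -> F j false p].
  move=> iT; have : ~ P (T :\ i)%SET.
    by move=> /Tmin/(_ (finset.subsetDl _ _)) e; move: iT; rewrite -e !inE eqxx.
  rewrite /P (fintype.subset_trans (finset.subsetDl _ _) TE)/=.
  move=> /negP/asboolPn/existsNP[p /not_implyP[mp]].
  move=> /negP/negPn/eqP pT.
  have jp j : j \in T -> j != i -> F j false p.
    move=> jT ji; apply: (@notin_covering (T :\ i)); first by rewrite !inE ji.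
    by rewrite pT inE.
  exists p; split=> //; have /set0Pn[j /coveringP[jT Oj]] := Thit p mp.
  have [<-//|ji] := eqVneq j i.
  by case: (jp _ jT ji).
exists T => // p mp; split; first exact: Thit.
(* Counting at [q] is enough: members that cover [q] also cover [p], and at most two of those at [q]
   are in [T]. *)
have [q [qp mq qm]] := covering_shrink_to m0 mp.
have q2 : (#|covering T q| <= 2)%N.
  rewrite leqNgt; apply/negP => /card_gt2P[l [t [r [[hl ht hr] [lt tr rl]]]]].
  have lr : l != r by rewrite eq_sym.
  have lTq i : i \in [:: l; t; r] -> i \in covering T q.
    by rewrite !in_cons => /or4P[/eqP->|/eqP->|/eqP->|].
  have Oq i : i \in [:: l; t; r] -> O i true q by move/lTq/coveringP => [].
  have lT i : i \in [:: l; t; r] -> i \in T by move/lTq/coveringP => [].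
  have uniq_ltr : uniq [:: l; t; r] by rewrite /= !inE negb_or lt lr tr.
  apply: (@no_three_private_sides l t r q J) => //;
    try by apply: Oq; rewrite !inE eqxx ?orbT.
    move=> i /lT iT; split; first exact: (fintype.subsetP TJ).
    by have := fintype.subsetP TE _ iT; rewrite inE => /andP[_ /asboolP].
  move=> i il; have [x [mx ix xT]] := priv i (lT _ il).
  exists x; split=> //; first by move=> j /lT; exact: xT.
  apply: contrapT => nex.
  (* Without an exception [a], all members covering [x] cover [q], and the two of [l], [t], [r]
     other than [i] cover [q] but not [x]. This leaves at most [m.+1 - 2] members at [x], fewer than
     [m]. *)
  suff : (#|covering J x| <= #|covering J q| - 2)%N by lia.
  have sub : (covering J x \subset
      covering J q :\: [set j in rem i [:: l; t; r]])%SET.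
    apply/fintype.subsetP => a /coveringP[aJ ax].
    rewrite inE; apply/andP; split.
      rewrite inE mem_rem_uniq// inE; apply/negP => /andP[ai al].
      by case: (xT a (lT _ al) ai).
    apply/coveringP; split=> //; apply: contrapT => aq; apply: nex.
    by exists a.
  apply: leq_trans (subset_leq_card sub) _; rewrite cardsD leq_sub2l//.
  rewrite (finset.setIidPr _); last first.
    apply/fintype.subsetP => j; rewrite inE => /mem_rem jl.
    apply/coveringP; split; last exact: Oq.
    exact/(fintype.subsetP TJ)/lT.
  by rewrite cardsE (card_uniqP _) ?rem_uniq// size_rem.
have : (covering J q :\: covering T q \subset covering (J :\: T) p)%SET.
  apply/fintype.subsetP => i; rewrite inE => /andP[iTq iq].
  have /coveringP[iJ Oi] := iq.
  apply/coveringP; split; last by have /coveringP[] := fintype.subsetP qp _ iq.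
  by rewrite inE iJ andbT; apply: contra iTq => iT; exact/coveringP.
move=> /subset_leq_card; rewrite cardsD => h.
have := subset_leq_card (finset.subsetIr (covering J q) (covering T q)).
lia.
Qed.

End uncovered.

(** * Hitting sets and the coloring *)

Lemma shallow_hitting (J : {set I}) m : (0 < m)%N -> exists2 T : {set I},
  (T \subset J)%SET & forall p, (m <= #|covering J p|)%N ->
    covering T p != finset.set0 /\ (m <= #|covering (J :\: T) p| + 3)%N.
Proof.
move=> m0; have [Jcov|/existsNP[z /negP/negPn/eqP zJ]] :=
  pselect (forall x, covering J x != finset.set0).
  (* When every point is covered, three members suffice to hit all points, and removing them costs
     at most 3. *)
  have [T TJ [T3 Tcov]] := cover_by_three Jcov.
  exists T => // p mp; split=> //.
  apply: leq_trans mp _; rewrite -(cardsID T) addnC; apply: leq_add.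
    apply: subset_leq_card; apply/fintype.subsetP => i.
    rewrite inE => /andP[iT /coveringP[iJ ip]].
    by apply/coveringP; rewrite inE iT.
  exact: leq_trans (subset_leq_card (finset.subsetIr _ _)) T3.
have [|T TJ TP] := @shallow_hitting_uncovered J z _ m m0.
  by move=> i iJ; apply: notin_covering iJ _; rewrite zJ inE.
exists T => // p /TP[? ?]; split=> //; lia.
Qed.

(** Color [k] goes to a hitting set for depth [3 * k.+1 - 2]; a loss of at most 3 leaves the depth
    [3 * k - 2] that the first [k] colors require. *)
Lemma polychromatic (k : nat) (J : {set I}) : exists color : I -> nat,
  forall p, (3 * k - 2 <= #|covering J p|)%N ->
    forall c, (c < k)%N -> exists2 i, i \in covering J p & color i = c.
Proof.
elim: k J => [|k IH] J; first by exists (fun=> 0%N).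
have [|T TJ TP] := @shallow_hitting J (3 * k.+1 - 2)%N; first by lia.
have [color colorP] := IH (J :\: T)%SET.
exists (fun i => if i \in T then k else color i) => p.
move=> /TP[/set0Pn[i /coveringP[iT ip]] pm] c.
rewrite ltnS leq_eqVlt => /predU1P[->|ck].
  exists i; last by rewrite iT.
  by apply/coveringP; split=> //; exact: (fintype.subsetP TJ).
have [|j /coveringP[]] := colorP p _ c ck; first by lia.
rewrite inE => /andP[/negPf jT jJ] jp jc.
by exists j; [exact/coveringP|rewrite jT].
Qed.

End sided_arrangement.

(** * From pseudohalfplanes to sided arrangements *)

Lemma open_side (R : realType) (L H : set (plane R)) :
  closed L -> sides L H -> open H.
Proof.
by move=> /closed_openC oL [x Lx <-]; exact: open_connected_component.
Qed.

Lemma side_curve (R : realType) (L H : set (plane R)) x :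
  sides L H -> H x -> ~ L x.
Proof. by move=> [z _ <-] /connected_component_sub. Qed.

Lemma connected_sub_side (R : realType) (L H C : set (plane R)) :
  sides L H -> connected C -> C `<=` ~` L ->
  C `<=` H \/ (forall x, C x -> ~ H x).
Proof.
move=> [z Lz <-] Cc CL.
have [[x [Cx zx]]|nC] :=
  pselect (exists x, C x /\ connected_component (~` L) z x).
  left=> y Cy; apply: connected_component_trans zx _.
  exact: connected_component_max Cy.
by right=> x Cx zx; apply: nC; exists x.
Qed.

Lemma open_other_side (R : realType) (L H : set (plane R)) :
  closed L -> sides L H -> open (~` (L `|` H)).
Proof.
move=> /closed_openC oL LH; rewrite openE => x /= LHx; rewrite /interior.
have Lx : (~` L) x by move=> ?; apply: LHx; left.
have xx := connected_component_refl Lx.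
have : nbhs x (connected_component (~` L) x).
  by apply: open_nbhs_nbhs; split=> //; exact: open_connected_component.
apply: filterS => y xy [/(connected_component_sub xy)//|Hy].
have [xH|] := connected_sub_side LH (@component_connected _ _ _)
  (@connected_component_sub _ _ x).
  by apply: LHx; right; exact: xH.
by move/(_ _ xy).
Qed.

(** As [L] has exactly two sides, [H] is one of the two between which [M] changes. *)
Lemma changes_side_meets (R : realType) (M L H : set (plane R)) p :
  pseudoline L -> sides L H -> changes_side M L p ->
  (exists2 x, M x & H x) /\ (exists2 y, M y & ~ H y /\ ~ L y).
Proof.
move=> [_ [A0 [B0 [_ sE]]]] sH [g [t [_ <- _ [A [B [sA sB AB gA gB]]]]]].
have [a /= Aa] := @filter_ex _ _ (at_left_proper_filter t) _ gA.
have [b /= Bb] := @filter_ex _ _ (at_right_proper_filter t) _ gB.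
have AB0 : forall x, A x -> B x -> False.
  move: sA sB AB => [y _ <-] [z _ <-] yz x yx zx; apply: yz.
  by rewrite (same_connected_component yx) (same_connected_component zx).
have [HA|HB] : H = A \/ H = B.
  by move: sH sA sB AB; rewrite sE => -[]->[]->[]->; auto.
- split; first by exists (g a); [exists a|rewrite HA].
  exists (g b); first by exists b.
  by split; [rewrite HA => /AB0; exact|exact: side_curve Bb].
- split; first by exists (g b); [exists b|rewrite HB].
  exists (g a); first by exists a.
  by split; [rewrite HB; exact: AB0|exact: side_curve Aa].
Qed.

(** Crossing becomes the sign of an affine function of the parameter of [g i]: a nonzero constant
    for disjoint curves, [t - t0] or [t0 - t] for curves that meet at parameter [t0]. *)
Lemma pseudohalfplane_sided (R : realType) (I : finType)
    (L H : I -> set (plane R)) : pseudohalfplane_arrangement L H ->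
  exists2 g : I -> R -> plane R, (forall i, range (g i) = L i) &
    sided_arrangement g (fun i b => if b then H i else ~` (L i `|` H i)).
Proof.
move=> [LA sH].
have /choice[g gP] i : exists g : R -> plane R,
    simple_curve_to_infinity g /\ range g = L i.
  by have [[g] ] := arr_pseudoline LA i; exists g.
have gc i := (gP i).1; have gL i := (gP i).2.
have Lc i : closed (L i) by rewrite -gL; exact: closed_curve (gc i).
exists g => //; split=> //.
- by move=> i [|]; [exact: open_side (sH i)|exact: open_other_side (sH i)].
- move=> i b x; rewrite gL; case: b => /=.
    split=> [Hx|[/contrapT[]//]].
    by have Lx := side_curve (sH i) Hx; split=> // -[]; right.
  split=> [LHx|[Hx Lx] []//].
  by split=> ?; apply: LHx; [right|left].
- move=> i j ij.
  have ray (C : set R) : is_interval C -> (forall t, C t -> ~ L j (g i t)) ->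
      (forall t, C t -> H j (g i t)) \/ (forall t, C t -> ~ H j (g i t)).
    move=> Citv CL.
    have [|x [t Ct <-]|h|h] := @connected_sub_side _ _ _ (g i @` C) (sH j).
    + apply: connected_continuous_connected; first exact/connected_intervalP.
      by apply: continuous_subspaceT; have [] := gc i.
    + exact: CL.
    + by left=> t Ct; apply: h; exists t.
    + by right=> t Ct; apply: h; exists t.
  have [Lij|[p Lij [/(changes_side_meets (arr_pseudoline LA j) (sH j)) + _]]] :=
    arr_meet LA ij.
    have Lg t : ~ L j (g i t).
      move=> Lt; have : (L i `&` L j) (g i t).
        by split=> //; rewrite -gL; exists t.
      by rewrite Lij.
    have [| |h|h] := ray setT; [by []|by []| |].
      exists 0, 1; split=> [|t|t]; rewrite ?oner_eq0 ?orbT//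
      mul0r add0r.
        by rewrite ltr01; split=> // _; exact: h.
      by rewrite ltr10; split=> // -[]; right; exact: h.
    exists 0, (-1); split=> [|t|t]; rewrite ?oppr_eq0 ?oner_eq0 ?orbT//
      mul0r add0r.
      by rewrite ltr0N1; split=> // Ht; case: (h t).
    by rewrite ltrN10; split=> // _ [/Lg//|Ht]; case: (h t).
  have [t0 _ t0p] : range (g i) p.
    by rewrite gL; have : [set p] p by []; rewrite -Lij => -[].
  have Lg t : L j (g i t) <-> t = t0.
    split=> [Lt|->]; last first.
      by rewrite t0p; have : [set p] p by []; rewrite -Lij => -[].
    have [_ ginj _ _] := gc i; apply: ginj; rewrite ?inE//.
    have : (L i `&` L j) (g i t) by split=> //; rewrite -gL; exists t.
    by rewrite Lij t0p.
  (* Each open ray of curve [i] avoids [L j], so it is inside [H j] or outside. Two rays of the same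
     kind contradict the points [a] and [b] given by the crossing; the mixed cases fix the sign of
     the slope. *)
  have lray := ray [set t | t < t0]; have rray := ray [set t | t0 < t].
  rewrite -(gL i) => -[[_ [a _ <-] Ha] [_ [b _ <-] [Hb Lb]]].
  have La := side_curve (sH j) Ha.
  have Ht0 : ~ H j (g i t0) by move=> /(side_curve (sH j)); apply; exact/Lg.
  have [| |h1|h1] := lray.
  - by move=> u v _ /= vt w /andP[_ wv]; exact: le_lt_trans vt.
  - by move=> t /= tt0 /Lg e; rewrite e ltxx in tt0.
  - have [| |h2|h2] := rray.
    + by move=> u v /= ut _ w /andP[uw _]; exact: lt_le_trans uw.
    + by move=> t /= tt0 /Lg e; rewrite e ltxx in tt0.
    + case: Hb; have [bt|bt|bt] := ltgtP b t0; [exact: h1|exact: h2|].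
      by case: Lb; apply/Lg.
    + exists (-1), t0; split=> [|t|t]; rewrite ?oppr_eq0 ?oner_eq0//
        mulN1r addrC.
        rewrite subr_gt0; have [tt0|tt0|->] := ltgtP t t0; split=> //.
          by move=> _; exact: h1.
        by move=> Ht; case: (h2 t).
      rewrite subr_lt0; have [tt0|tt0|->] := ltgtP t t0; split=> //.
      + by apply: contra_notP => _; right; exact: h1.
      + move=> _ [/Lg e|Ht]; last by case: (h2 t).
        by rewrite e ltxx in tt0.
      + by apply: contra_notP => _; left; exact/Lg.
  - have [| |h2|h2] := rray.
    + by move=> u v /= ut _ w /andP[uw _]; exact: lt_le_trans uw.
    + by move=> t /= tt0 /Lg e; rewrite e ltxx in tt0.
    + exists 1, (- t0); split=> [|t|t]; rewrite ?oner_eq0// mul1r.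
        rewrite subr_gt0; have [tt0|tt0|->] := ltgtP t t0; split=> //.
          by move=> Ht; case: (h1 t).
        by move=> _; exact: h2.
      rewrite subr_lt0; have [tt0|tt0|->] := ltgtP t t0; split=> //.
      + move=> _ [/Lg e|Ht]; last by case: (h1 t).
        by rewrite e ltxx in tt0.
      + by apply: contra_notP => _; right; exact: h2.
      + by apply: contra_notP => _; left; exact/Lg.
    + case: La; apply/Lg; have [at0|at0|//] := ltgtP a t0.
        by case: (h1 a).
      by case: (h2 a).
- move=> i j k x ij ik jk; rewrite !gL => Lx Ly Lz.
  have : (L i `&` L j `&` L k) x by [].
  by rewrite (arr_general_position LA ij ik jk).
Qed.

Theorem theorem4p1 (R : realType) (k : nat) (hk : (1 <= k)%N) (I : finType)
    (L H : I -> set (plane R)) (hH : pseudohalfplane_arrangement L H) :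
  exists color : I -> 'I_k,
    forall p : plane R, (3 * k - 2 <= #|containing H p|)%N ->
      forall c : 'I_k, exists2 i : I, i \in containing H p & color i = c.
Proof.
have [g _ gO] := pseudohalfplane_sided hH.
have [color colorP] := polychromatic gO k [set: I].
(* Color 0, which exists by [hk], is the default of [insubd] for values outside the range. *)
exists (fun i => insubd (Ordinal hk) (color i)) => p.
have -> : containing H p = covering
    (fun i b => if b then H i else ~` (L i `|` H i)) [set: I] p.
  by apply/setP => i; rewrite !inE.
move=> /colorP pP c; have [i ip ic] := pP c (ltn_ord c).
by exists i => //; apply: val_inj; rewrite val_insubd ic ltn_ord.
Qed.
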